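(* Let $m$ and $u$ be integers with $0 \le u < m-1$. Then there is an isomorphism of chain complexes $$C_\bullet^{m,u} \;\cong\; \bigoplus_{j=u+1}^{m} \binom{m-u-1}{j-u-1}\, C_\bullet^{jf}.$$ In particular, taking $u=0$, $$C_\bullet^{m} \;\cong\; \bigoplus_{j=1}^{m} \binom{m-1}{j-1}\, C_\bullet^{jf}.$$ Here $N\,C_\bullet$ denotes the direct sum of $N$ copies of the chain complex $C_\bullet$.
   Context: Let $k$ be a commutative ring with identity with a fixed element denoted $y^2$ (the main case is the polynomial ring $k=\mathbb{Z}[y^2]$). For $m\ge 1$ let $X_{(m)}=\{v_1,\dots,v_m\}$ be ordered by $v_i<v_j$ iff $i<j$, and let $V_{(m)}=kX_{(m)}$ be the free $k$-module on $X_{(m)}$. Basis elements $a_1\otimes\cdots\otimes a_n$ of $V_{(m)}^{\otimes n}$ (with $a_i\in X_{(m)}$) are written as tuples $(a_1,\dots,a_n)$. The normalized Yang-Baxter operator $R_{(m)}:V_{(m)}\otimes V_{(m)}\to V_{(m)}\otimes V_{(m)}$ is the $k$-linear map with $R_{(m)}(a,b)=(b,a)$ if $a\ge b$, and $R_{(m)}(a,b)=(1-y^2)(a,b)+y^2(b,a)$ if $a<b$. Chain complex $C_\bullet^m$: $C_n^m=V_{(m)}^{\otimes n}$ for $n\ge 0$ ($C_0^m=k$, $C_n^m=0$ for $n<0$). For $1\le i\le n$, $d_i^{\ell}:C_n^m\to C_{n-1}^m$ applies $R_{(m)}$ to tensor positions $(i-1,i)$, then $(i-2,i-1)$, ...,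 then $(1,2)$, and then deletes the first tensor factor of each basis tuple; $d_i^{r}:C_n^m\to C_{n-1}^m$ applies $R_{(m)}$ to positions $(i,i+1)$, then $(i+1,i+2)$, ..., then $(n-1,n)$, and then deletes the last tensor factor of each basis tuple. The differential is $\partial_n=\sum_{i=1}^n(-1)^i(d_i^{\ell}-d_i^{r})$. Complexes $C_\bullet^{m,u}$: for $0\le u\le m$, the span of all tuples over $X_{(m)}$ which omit at least one of the top $u$ letters $v_{m-u+1},\dots,v_m$ is a subcomplex of $C_\bullet^m$, and $C_\bullet^{m,u}$ is the quotient of $C_\bullet^m$ by it. Thus $C_n^{m,u}$ is free with basis the (classes of) $n$-tuples over $X_{(m)}$ which use each of the top $u$ letters at least once, and tuples not using all of these letters are set to zero in the induced differential. In particular $C_\bullet^{m,0}=C_\bullet^m$. Equivalently, inductively, $C_\bullet^{m,u+1}$ is the quotient of $C_\bullet^{m,u}$ by the subcomplex spanned by tuples not using the letter $v_{m-u}$. Final complexes: $C_\bullet^{jf}:=C_\bullet^{j,j-1}$ for $j\ge 1$ (basis: tuples over $X_{(j)}$ using each of $v_2,\dots,v_j$ at least once; $C_\bullet^{1f}=C_\bullet^1$). *)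

(* Defs.v *)
From HB Require Import structures.
From mathcomp Require Import all_boot all_order all_fingroup all_algebra.
From mathcomp Require Import ring zify.

Set Implicit Arguments.
Unset Strict Implicit.
Unset Printing Implicit Defensive.

Import GRing.Theory.
Local Open Scope ring_scope.

(* Non-negatively graded chain complexes of k-modules: obj n sits in degree n, *)
(* all negative degrees are zero, and diff n goes from degree n.+1 to degree n *)
Record complex (k : comPzRingType) := Complex {
  obj :> nat -> lmodType k;
  diff : forall n, {linear obj n.+1 -> obj n};
  diff_diff : forall n x, diff n (diff n.+1 x) = 0 }.

Definition complex_iso (k : comPzRingType) (C D : complex k) : Prop :=
  exists f : forall n, {linear C n -> D n},
    (forall n, bijective (f n)) /\
    (forall n x, f n (diff C n x) = diff D n (f n.+1 x)).

Section DirectSum.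
Variable k : comPzRingType.

Let rV0_zero : {linear 'rV[k]_0 -> 'rV[k]_0} := \0.

Fact zero_diff_diff (n : nat) (x : 'rV[k]_0) : rV0_zero (rV0_zero x) = 0.
Proof. by []. Qed.

Definition zero_complex : complex k :=
  @Complex k (fun=> 'rV[k]_0) (fun=> rV0_zero) zero_diff_diff.

Variables C D : complex k.

Definition dsum_diff n (x : C n.+1 * D n.+1) : C n * D n :=
  (diff C n x.1, diff D n x.2).

Fact dsum_diff_linear n : linear (@dsum_diff n).
Proof. by move=> a x y; rewrite /dsum_diff /= !linearP. Qed.

HB.instance Definition _ n := GRing.isLinear.Build k (C n.+1 * D n.+1)%type
  (C n * D n)%type _ (@dsum_diff n) (@dsum_diff_linear n).

Fact dsum_diff_diff n x : @dsum_diff n (@dsum_diff n.+1 x) = 0.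
Proof. by rewrite /dsum_diff /= !diff_diff. Qed.

Definition dsum : complex k :=
  @Complex k (fun n => (C n * D n)%type : lmodType k)
    (fun n => @dsum_diff n) dsum_diff_diff.

End DirectSum.

Definition copies (k : comPzRingType) (N : nat) (C : complex k) : complex k :=
  iter N (dsum C) (zero_complex k).

Section FreeModule.
Variable k : comPzRingType.

Definition freemod (T : finType) := {ffun T -> k^o}.
HB.instance Definition _ (T : finType) := GRing.Lmodule.on (freemod T).

Definition fbasis (T : finType) (t : T) : freemod T := [ffun s => (s == t)%:R].

Definition lext (S T : finType) (f : S -> freemod T) (x : freemod S) :
    freemod T :=
  \sum_s (x s : k) *: f s.

Fact lext_linear (S T : finType) (f : S -> freemod T) : linear (lext f).
Proof.
move=> a x y; rewrite /lext scaler_sumr -big_split /=; apply: eq_bigr => s _.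
by rewrite !ffunE scalerDl scalerA.
Qed.

HB.instance Definition _ (S T : finType) f :=
  GRing.isLinear.Build k (freemod S) (freemod T) _
  (@lext S T f) (lext_linear f).

Lemma freeE (T : finType) (x : freemod T) : x = \sum_t (x t : k) *: fbasis t.
Proof.
apply/ffunP=> s; rewrite sum_ffunE (bigD1 s) //= big1 => [|t /negPf ts].
  by rewrite !ffunE eqxx addr0 /GRing.scale /= mulr1.
by rewrite !ffunE eq_sym ts scaler0.
Qed.

Lemma lext_basis (S T : finType) (f : S -> freemod T) s : lext f (fbasis s) = f s.
Proof.
rewrite /lext (bigD1 s) //= big1 => [|t /negPf ts].
  by rewrite ffunE eqxx scale1r addr0.
by rewrite ffunE ts scale0r.
Qed.

Lemma free_ext (T : finType) (V : lmodType k) (f g : freemod T -> V) :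
  linear f -> linear g -> (forall t, f (fbasis t) = g (fbasis t)) -> f =1 g.
Proof.
move=> lf lg fg x.
pose F : {linear freemod T -> V} := HB.pack f (GRing.isLinear.Build _ _ _ _ f lf).
pose G : {linear freemod T -> V} := HB.pack g (GRing.isLinear.Build _ _ _ _ g lg).
rewrite -[f x]/(F x) -[g x]/(G x) (freeE x) !linear_sum.
by apply: eq_bigr => t _; rewrite !linearZ /= fg.
Qed.

Definition ev (T : finType) (t : T) (x : freemod T) : k := x t.

Lemma free_eq (T : finType) (x y : freemod T) : (forall t, ev t x = ev t y) -> x = y.
Proof. by move=> xy; apply/ffunP. Qed.

Lemma ev_lin (T : finType) (t : T) a b (x y : freemod T) :
  ev t (a *: x + b *: y) = a * ev t x + b * ev t y.
Proof. by rewrite /ev !ffunE. Qed.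

End FreeModule.

Lemma braid_scalar (k : comPzRingType) (y2 : k) (a b c : nat) (x x1 x2 x12 x21 w : k)
  (A := fun p q : nat => if (q <= p)%N then 0 else 1 - y2)
  (B := fun p q : nat => if (q <= p)%N then 1 else y2) :
  (a = b -> [/\ x1 = x, x21 = x2 & w = x12]) ->
  (b = c -> [/\ x2 = x, x12 = x1 & w = x21]) ->
  (a = c -> [/\ x21 = x1, x12 = x2 & w = x]) ->
  A a b * (A b c * (A a b * x + B a b * x1) + B b c * (A a c * x2 + B a c * x12)) +
  B a b * (A a c * (A b a * x1 + B b a * x) + B a c * (A b c * x21 + B b c * w)) =
  A b c * (A a b * (A b c * x + B b c * x2) + B a b * (A a c * x1 + B a c * x21)) +
  B b c * (A a c * (A c b * x2 + B c b * x) + B a c * (A a b * x12 + B a b * w)).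
Proof.
rewrite {}/A {}/B => ab bc ac.
have [lab|lba|eab] := ltngtP a b; have [lbc|lcb|ebc] := ltngtP b c;
  have [lac|lca|eac] := ltngtP a c; try lia; try by clear; ring.
all: try (case: (ab eab) => ? ? ?); try (case: (bc ebc) => ? ? ?);
  try (case: (ac eac) => ? ? ?); clear ab bc ac; subst.
all: by ring.
Qed.

Section YangBaxter.
Variables (k : comPzRingType) (y2 : k) (m : nat).

(* The letter v_(i+1) is represented by i : 'I_m, and V^{\otimes n} by the free *)
(* module on n-letter words.                                                   *)
Local Notation V n := (freemod k (n.-tuple 'I_m)).

Definition permw n (s : 'S_n) (t : n.-tuple 'I_m) : n.-tuple 'I_m :=
  [tuple tnth t (s i) | i < n].

(* The normalized Yang-Baxter operator applied to the tensor factors at        *)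
(* positions i and j, which hold the letters a = tnth t i and b = tnth t j.    *)
Definition YB n (i j : 'I_n) : V n -> V n :=
  lext (fun t : n.-tuple 'I_m =>
    if (tnth t j <= tnth t i)%N then fbasis k (permw (tperm i j) t)
    else (1 - y2) *: fbasis k t + y2 *: fbasis k (permw (tperm i j) t)).

(* R at positions p and p + 1, counted from 0; meaningful for p < n. *)
Definition YBat n (p : nat) : V n.+1 -> V n.+1 := YB (inord p) (inord p.+1).

Arguments YBat : clear implicits.

Definition del n (l : 'I_n.+1) (t : n.+1.-tuple 'I_m) : n.-tuple 'I_m :=
  [tuple tnth t (lift l i) | i < n].

Definition Del n (l : 'I_n.+1) : V n.+1 -> V n := lext (fun t => fbasis k (del l t)).

(* The index i : nat is shifted: dl i and dr i are $d^\ell_{i+1}$, $d^r_{i+1}$. *)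
Definition dl n (i : nat) (x : V n.+1) : V n :=
  Del ord0 (foldr (YBat n) x (iota 0 i)).

Definition dr n (i : nat) (x : V n.+1) : V n :=
  Del ord_max (foldl (fun z p => YBat n p z) x (iota i (n - i))).

Arguments dl : clear implicits.
Arguments dr : clear implicits.

Definition bd n (x : V n.+1) : V n :=
  \sum_(i < n.+1) (-1) ^+ i.+1 *: (dl n i x - dr n i x).
Arguments bd : clear implicits.

HB.instance Definition _ n i j := GRing.Linear.copy (@YB n i j) (lext _).
HB.instance Definition _ n p := GRing.Linear.copy (YBat n p) (@YB n.+1 _ _).
HB.instance Definition _ n l := GRing.Linear.copy (@Del n l) (lext _).

Fact dl_linear n i : linear (dl n i).
Proof.
move=> a x y; rewrite /dl -linearP; congr (Del _ _).
by elim: (iota 0 i) => //= p s ->; rewrite linearP.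
Qed.

Fact dr_linear n i : linear (dr n i).
Proof.
move=> a x y; rewrite /dr -linearP; congr (Del _ _).
by elim: (iota i (n - i)) x y => //= p s IH x y; rewrite linearP IH.
Qed.

HB.instance Definition _ n i :=
  GRing.isLinear.Build k (V n.+1) (V n) _ (dl n i) (@dl_linear n i).
HB.instance Definition _ n i :=
  GRing.isLinear.Build k (V n.+1) (V n) _ (dr n i) (@dr_linear n i).

Fact bd_linear n : linear (bd n).
Proof.
move=> a x y; rewrite /bd scaler_sumr -big_split /=; apply: eq_bigr => i _.
rewrite scalerA mulrC -scalerA -scalerDr; congr (_ *: _).
by rewrite dl_linear dr_linear scalerBr opprD addrACA.
Qed.

HB.instance Definition _ n :=
  GRing.isLinear.Build k (V n.+1) (V n) _ (bd n) (@bd_linear n).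

Lemma tnth_permw n (s : 'S_n) t i : tnth (permw s t) i = tnth t (s i).
Proof. by rewrite tnth_mktuple. Qed.

Lemma permwM n (s s' : 'S_n) t : permw s (permw s' t) = permw (s * s')%g t.
Proof. by apply: eq_from_tnth => i; rewrite !tnth_permw permM. Qed.

Lemma YB_basis n (i j : 'I_n) t : YB i j (fbasis k t) =
  if (tnth t j <= tnth t i)%N then fbasis k (permw (tperm i j) t)
  else (1 - y2) *: fbasis k t + y2 *: fbasis k (permw (tperm i j) t).
Proof. exact: lext_basis. Qed.

Lemma YB_lin n (i j : 'I_n) a b x y :
  YB i j (a *: x + b *: y) = a *: YB i j x + b *: YB i j y.
Proof. by rewrite linearD !linearZ. Qed.

Lemma YB_coef n (i j : 'I_n) (t : n.-tuple 'I_m) (le := (tnth t j <= tnth t i)%N) :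
  YB i j (fbasis k t) = (if le then 0 else 1 - y2) *: fbasis k t
                     + (if le then 1 else y2) *: fbasis k (permw (tperm i j) t).
Proof. by rewrite YB_basis /le; case: ifP; rewrite ?scale0r ?add0r ?scale1r. Qed.

Lemma Del_basis n (l : 'I_n.+1) t : Del l (fbasis k t) = fbasis k (del l t).
Proof. exact: lext_basis. Qed.

Lemma YB_Del n (i j : 'I_n) (l : 'I_n.+1) x :
  YB i j (Del l x) = Del l (YB (lift l i) (lift l j) x).
Proof.
move: x; apply: free_ext => [a x y|a x y|t]; rewrite ?linearP //.
have E : permw (tperm i j) (del l t) = del l (permw (tperm (lift l i) (lift l j)) t).
  apply: eq_from_tnth => p; rewrite tnth_permw !tnth_mktuple.
  by rewrite -inj_tperm //; apply: lift_inj.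
rewrite Del_basis !YB_basis E !tnth_mktuple.
by case: ifP => _; rewrite ?linearD ?linearZ /= !Del_basis.
Qed.


Lemma YB_comm n (i j i' j' : 'I_n) x :
  i != i' -> i != j' -> j != i' -> j != j' ->
  YB i j (YB i' j' x) = YB i' j' (YB i j x).
Proof.
move=> ii ij ji jj.
have [? ? ? ?] : [/\ i' != i, i' != j, j' != i & j' != j].
  by rewrite ![_ == i]eq_sym ![_ == j]eq_sym.
move: x; apply: free_ext => [a x y|a x y|t]; rewrite ?linearP //.
have E : permw (tperm i j) (permw (tperm i' j') t) = permw (tperm i' j') (permw (tperm i j) t).
  rewrite !permwM; congr (permw _ t); apply: commute_sym; apply/commgP/conjg_fixP.
  by rewrite tpermJ !tpermD // eq_sym.
rewrite !YB_coef !YB_lin !YB_coef !tnth_permw.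
rewrite !(tpermD (x := i) (y := j)) ?(tpermD (x := i') (y := j')) // E.
apply: free_eq => w; rewrite !ev_lin.
generalize (tnth t j <= tnth t i)%N (tnth t j' <= tnth t i')%N => c c'; ring.
Qed.

Lemma YB_braid n (i j l : 'I_n) x : i != j -> i != l -> j != l ->
  YB i j (YB j l (YB i j x)) = YB j l (YB i j (YB j l x)).
Proof.
move=> ij il jl; move: x; apply: free_ext => [a x y|a x y|t]; rewrite ?linearP //.
set s1 := tperm i j; set s2 := tperm j l.
have [? ? ?] : [/\ j != i, l != i & l != j] by rewrite ![_ == i]eq_sym [l == j]eq_sym.
have B u : permw s1 (permw s2 (permw s1 u)) = permw s2 (permw s1 (permw s2 u)).
  rewrite !permwM; congr (permw _ u).
  have -> : (s2 * s1 * s2 = s1 ^ s2)%g by rewrite conjgE tpermV -?mulgA.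
  have -> : (s1 * s2 * s1 = s2 ^ s1)%g by rewrite conjgE tpermV -?mulgA.
  by rewrite !tpermJ tpermL tpermR !tpermD // tpermC.
have K1 u : permw s1 (permw s1 u) = u.
  by apply: eq_from_tnth => p; rewrite !tnth_permw tpermK.
have K2 u : permw s2 (permw s2 u) = u.
  by apply: eq_from_tnth => p; rewrite !tnth_permw tpermK.
have H1 : tnth t i = tnth t j -> permw s1 t = t.
  by move=> e; apply: eq_from_tnth => p; rewrite tnth_permw; case: tpermP => // ->.
have H2 : tnth t j = tnth t l -> permw s2 t = t.
  by move=> e; apply: eq_from_tnth => p; rewrite tnth_permw; case: tpermP => // ->.
have H3 : tnth t i = tnth t l -> permw s1 (permw s2 (permw s1 t)) = t.
  move=> e; rewrite !permwM -mulgA.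
  have -> : (s1 * (s2 * s1) = s2 ^ s1)%g by rewrite conjgE tpermV -?mulgA.
  rewrite tpermJ tpermR tpermD //.
  by apply: eq_from_tnth => p; rewrite tnth_permw; case: tpermP => // ->.
have E1 : (s1 i = j) * (s1 j = i) * (s1 l = l).
  by rewrite /s1 tpermL tpermR tpermD.
have E2 : (s2 j = l) * (s2 l = j) * (s2 i = i).
  by rewrite /s2 tpermL tpermR tpermD // eq_sym.
have Y1 u := YB_coef i j u; have Y2 u := YB_coef j l u.
rewrite -/s1 in Y1; rewrite -/s2 in Y2.
have A1 (u : n.-tuple 'I_m) p : tnth (permw s1 u) p = tnth u (s1 p) by exact: tnth_permw.
have A2 (u : n.-tuple 'I_m) p : tnth (permw s2 u) p = tnth u (s2 p) by exact: tnth_permw.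
rewrite Y1 Y2 !YB_lin !(Y1, Y2) !(A1, A2, E1, E2).
rewrite !YB_lin !(Y1, Y2) !(A1, A2, E1, E2) B !K1 !K2.
clear A1 A2 E1 E2 Y1 Y2; apply: free_eq => w; rewrite !ev_lin.
apply: braid_scalar => /val_inj e.
- by have h := H1 e; rewrite -B !h.
- by have h := H2 e; rewrite !h.
- have h := H3 e.
  have h1 : permw s2 (permw s1 t) = permw s1 t by rewrite -[t in RHS]h K1.
  have h2 : permw s1 (permw s2 t) = permw s2 t by rewrite -[t in RHS]h B K2.
  by rewrite h1 h2 K2.
Qed.


Lemma inord_eq n p q : (p <= n)%N -> (q <= n)%N ->
  ((inord p : 'I_n.+1) == inord q) = (p == q).
Proof. by move=> pn qn; rewrite -val_eqE /= !inordK. Qed.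

Lemma YBat_comm n p q x : (p.+1 < q)%N -> (q < n)%N ->
  YBat n p (YBat n q x) = YBat n q (YBat n p x).
Proof. by move=> pq qn; apply: YB_comm; rewrite inord_eq; lia. Qed.

Lemma YBat_braid n p x : (p.+1 < n)%N ->
  YBat n p (YBat n p.+1 (YBat n p x)) = YBat n p.+1 (YBat n p (YBat n p.+1 x)).
Proof. by move=> pn; apply: YB_braid; rewrite inord_eq; lia. Qed.

Lemma lift0_inord n p : (p <= n)%N -> lift ord0 (inord p : 'I_n.+1) = inord p.+1.
Proof. by move=> pn; apply: val_inj; rewrite /= /bump !inordK. Qed.

Lemma liftm_inord n p : (p <= n)%N ->
  lift ord_max (inord p : 'I_n.+1) = inord p.
Proof. by move=> pn; apply: val_inj; rewrite /= /bump !inordK; lia. Qed.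

Lemma YBat_Del0 n p x : (p < n)%N ->
  YBat n p (Del ord0 x) = Del ord0 (YBat n.+1 p.+1 x).
Proof. by move=> pn; rewrite [LHS]YB_Del !lift0_inord //; lia. Qed.

Lemma YBat_Delm n p x : (p < n)%N ->
  YBat n p (Del ord_max x) = Del ord_max (YBat n.+1 p x).
Proof. by move=> pn; rewrite [LHS]YB_Del !liftm_inord //; lia. Qed.

Lemma Del_Del n (x : V n.+2) :
  Del ord0 (Del ord_max x) = Del ord_max (Del ord0 x).
Proof.
move: x; apply: free_ext => [a x y|a x y|t]; rewrite ?linearP // !Del_basis.
congr fbasis; apply: eq_from_tnth => p; rewrite !tnth_mktuple; congr tnth.
by apply: val_inj; rewrite /= /bump; have := ltn_ord p; lia.
Qed.

Lemma Del_Del_YB n (i j : 'I_n.+2) l l' x :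
  (forall p, lift l (lift l' p) != i) -> (forall p, lift l (lift l' p) != j) ->
  Del l' (Del l (YB i j x)) = Del l' (Del l x).
Proof.
move=> hi hj.
move: x; apply: free_ext => [a x y|a x y|t]; rewrite ?linearP //.
have E : del l' (del l (permw (tperm i j) t)) = del l' (del l t).
  apply: eq_from_tnth => p; rewrite !tnth_mktuple; congr tnth.
  by rewrite tpermD // eq_sym.
rewrite YB_coef linearD !linearZ linearD !linearZ /= !Del_basis E -scalerDl.
by case: ifP => _; rewrite ?add0r ?subrK scale1r.
Qed.

Lemma Del00 n x : Del ord0 (Del ord0 (YBat n.+1 0 x)) = Del ord0 (Del ord0 x).
Proof.
by apply: Del_Del_YB => p; rewrite -val_eqE /= inordK // /bump; lia.
Qed.

Lemma Delmm n x :
  Del ord_max (Del ord_max (YBat n.+1 n x)) = Del ord_max (Del ord_max x).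
Proof.
apply: Del_Del_YB => p; rewrite -val_eqE /= inordK // /bump;
  by have := ltn_ord p; lia.
Qed.

Definition ops n (s : seq nat) (x : V n.+1) : V n.+1 := foldr (YBat n) x s.

Arguments ops : clear implicits.

Lemma ops_cat n s s' x : ops n (s ++ s') x = ops n s (ops n s' x).
Proof. exact: foldr_cat. Qed.

Lemma ops_Del0 n s x : all (fun p => p < n)%N s ->
  ops n s (Del ord0 x) = Del ord0 (ops n.+1 (map succn s) x).
Proof.
by elim: s => //= p s IH /andP[pn /IH ->]; rewrite YBat_Del0.
Qed.

Lemma ops_Delm n s x : all (fun p => p < n)%N s ->
  ops n s (Del ord_max x) = Del ord_max (ops n.+1 s x).
Proof.
by elim: s => //= p s IH /andP[pn /IH ->]; rewrite YBat_Delm.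
Qed.

Lemma ops_comm1 n p s x : (p < n)%N ->
  all (fun q => (q < n) && ((p.+1 < q) || (q.+1 < p)))%N s ->
  YBat n p (ops n s x) = ops n s (YBat n p x).
Proof.
move=> pn; elim: s => //= q s IH /andP[/andP[qn /orP[pq|qp]] /IH <-].
  exact: YBat_comm.
by rewrite [RHS]YBat_comm.
Qed.

Lemma ops_comm n s s' x : all (fun p => p < n)%N s -> all (fun p => p < n)%N s' ->
  allrel (fun p q => (p.+1 < q) || (q.+1 < p))%N s s' ->
  ops n s (ops n s' x) = ops n s' (ops n s x).
Proof.
elim: s => //= p s IH /andP[pn sn] s'n /andP[ps' ss'].
rewrite IH // ops_comm1 //; apply/allP => q qs'.
by rewrite (allP s'n) // (allP ps').
Qed.

Definition up n j := ops n (iota 0 j).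
Definition dn n j := ops n (rev (iota j (n - j))).

Arguments up : clear implicits.
Arguments dn : clear implicits.

Lemma dlE n j x : dl n j x = Del ord0 (up n j x).
Proof. by []. Qed.

Lemma drE n j x : dr n j x = Del ord_max (dn n j x).
Proof. by rewrite /dn /ops -foldl_rev revK. Qed.

Lemma all_iota_lt n a b : (a + b <= n)%N -> all (fun p => p < n)%N (iota a b).
Proof. by move=> abn; apply/allP => p; rewrite mem_iota; lia. Qed.

Lemma slide_up n p j x : (p.+1 < j)%N -> (j <= n)%N ->
  YBat n p.+1 (up n j x) = up n j (YBat n p x).
Proof.
move=> pj jn; have -> : j = (p + (2 + (j - p.+2)))%N by lia.
rewrite /up !iotaD !ops_cat add0n /=.
rewrite ops_comm1; last 2 first.
- lia.
- by apply/allP => q; rewrite mem_iota; lia.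
rewrite -YBat_braid; last by lia.
rewrite ops_comm1 //; first by lia.
by apply/allP => q; rewrite mem_iota; lia.
Qed.

Lemma slide_dn n p j x : (j <= p)%N -> (p.+1 < n)%N ->
  YBat n p (dn n j x) = dn n j (YBat n p.+1 x).
Proof.
move=> pj jn; rewrite /dn.
have -> : (n - j = (p - j) + (2 + (n - p.+2)))%N by lia.
rewrite !iotaD !rev_cat !ops_cat /= subnKC //.
rewrite ops_comm1; last 2 first.
- lia.
- by apply/allP => q; rewrite mem_rev mem_iota; lia.
rewrite YBat_braid; last by lia.
rewrite ops_comm1 //.
by apply/allP => q; rewrite mem_rev mem_iota; lia.
Qed.

Lemma slides_up n s j x : all (fun p => p.+1 < j)%N s -> (j <= n)%N ->
  ops n (map succn s) (up n j x) = up n j (ops n s x).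
Proof. by move=> + jn; elim: s => //= p s IH /andP[pj /IH ->]; rewrite slide_up. Qed.

Lemma slides_dn n s j x : all (fun p => (j <= p) && (p.+1 < n))%N s ->
  ops n s (dn n j x) = dn n j (ops n (map succn s) x).
Proof.
by elim: s => //= p s IH /andP[/andP[jp pn] /IH ->]; rewrite slide_dn.
Qed.

Lemma map_succ_iota a b : map succn (iota a b) = iota a.+1 b.
Proof. by rewrite -[a.+1]add1n iotaDl. Qed.

Lemma dl_dl n i j x : (i < j)%N -> (j <= n.+1)%N ->
  dl n i (dl n.+1 j x) = dl n j.-1 (dl n.+1 i x).
Proof.
case: j => // j ij jn; rewrite !dlE.
rewrite /up !ops_Del0; try (by apply: all_iota_lt; lia).
rewrite -!/(up _ _ _).
rewrite slides_up; [|by apply/allP => p; rewrite mem_iota; lia|by lia].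
by rewrite map_succ_iota /= Del00.
Qed.

Lemma all_rev_iota_lt n a b : (a + b <= n)%N ->
  all (fun p => p < n)%N (rev (iota a b)).
Proof. by move=> abn; rewrite all_rev all_iota_lt. Qed.

Lemma up_Delm n i (x : V n.+2) : (i <= n)%N ->
  up n i (Del ord_max x) = Del ord_max (up n.+1 i x).
Proof. by move=> ni; apply: ops_Delm; apply: all_iota_lt. Qed.

Lemma dn_Delm n i (x : V n.+2) : (i <= n)%N ->
  dn n i (Del ord_max x) = Del ord_max (ops n.+1 (rev (iota i (n - i))) x).
Proof. by move=> ni; apply: ops_Delm; apply: all_rev_iota_lt; lia. Qed.

Lemma dn_Del0 n i (x : V n.+2) : (i <= n)%N ->
  dn n i (Del ord0 x) = Del ord0 (ops n.+1 (rev (iota i.+1 (n - i))) x).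
Proof.
by move=> ni; rewrite -map_succ_iota -map_rev; apply: ops_Del0; apply: all_rev_iota_lt; lia.
Qed.

Lemma dnS n i x : (i <= n)%N ->
  dn n.+1 i x = YBat n.+1 n (ops n.+1 (rev (iota i (n - i))) x).
Proof.
by move=> ni; rewrite /dn subSn // -[(n - i).+1]addn1 iotaD rev_cat ops_cat subnKC.
Qed.

Lemma dr_dr n i j x : (i < j)%N -> (j <= n.+1)%N ->
  dr n i (dr n.+1 j x) = dr n j.-1 (dr n.+1 i x).
Proof.
case: j => // j ij jn; rewrite !drE !dn_Delm /=; try lia.
rewrite [in RHS]slides_dn; last by apply/allP => p; rewrite mem_rev mem_iota; lia.
by rewrite map_rev map_succ_iota [in RHS]dnS ?Delmm //; lia.
Qed.

Lemma dl_dr n i j x : (i < j)%N -> (j <= n.+1)%N ->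
  dl n i (dr n.+1 j x) = dr n j.-1 (dl n.+1 i x).
Proof.
case: j => // j ij jn; rewrite !drE !dlE /= up_Delm ?dn_Del0; try lia.
rewrite Del_Del; congr (Del _ (Del _ _)); apply: ops_comm.
- by apply: all_iota_lt; lia.
- by apply: all_rev_iota_lt; lia.
- by apply/allrelP => p q; rewrite mem_rev !mem_iota; lia.
Qed.

Lemma dr_dl n i j x : (i < j)%N -> (j <= n.+1)%N ->
  dr n i (dl n.+1 j x) = dl n j.-1 (dr n.+1 i x).
Proof.
case: j => // j ij jn; rewrite !drE !dlE /= up_Delm ?dn_Del0; try lia.
rewrite Del_Del; congr (Del _ (Del _ _)); rewrite /dn.
have -> : (n - i = (j - i) + (n - j))%N by lia.
have -> : (n.+1 - i = (j - i).+1 + (n - j))%N by lia.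
rewrite !iotaD !rev_cat !ops_cat -map_succ_iota -map_rev slides_up; last 2 first.
- by apply/allP => p; rewrite mem_rev mem_iota; lia.
- by [].
rewrite {1}/up -[j.+1]addn1 iotaD ops_cat ops_comm; last 3 first.
- by apply: all_rev_iota_lt; lia.
- by apply: all_iota_lt; lia.
- by apply/allrelP => p q; rewrite mem_rev !mem_iota; lia.
congr (ops _ _ _); have -> : (i.+1 + (j - i) = i + (j - i).+1)%N by lia.
congr (ops _ _ _); rewrite -[(j - i).+1]addn1 [in RHS]iotaD rev_cat ops_cat subnKC //.
Qed.

Lemma alt_sum_diff (M : lmodType k) N (f : nat -> nat -> M) :
  (forall i j, (i < j)%N -> (j <= N)%N -> f i j = f j.-1 i) ->
  \sum_(i < N) \sum_(j < N.+1) (-1) ^+ (i + j) *: f i j = 0.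
Proof.
move=> fij.
pose g i j : M := (-1) ^+ (i + j) *: f i j.
have E (i : 'I_N) : \sum_(j < N.+1) g i j
    = \sum_(j < N | (j <= i)%N) g i j - \sum_(j < N | (i <= j)%N) g j i.
  rewrite (bigID (fun j : 'I_N.+1 => (j <= i)%N)) /=; congr (_ + _).
    rewrite big_mkcond big_ord_recr /= leqNgt ltn_ord addr0 -big_mkcond /=.
    by [].
  rewrite big_mkcond big_ord_recl /= add0r -sumrN [RHS]big_mkcond /=.
  apply: eq_bigr => j _; rewrite /bump add1n -ltnNge ltnS; case: ifP => // ij.
  rewrite /g fij //= addnS exprS mulN1r scaleNr addnC //.
rewrite (eq_bigr _ (fun i _ => E i)) big_split /= sumrN.
by rewrite [X in _ - X](exchange_big_dep predT) //= subrr.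
Qed.

Lemma dlB n i x y : dl n i (x - y) = dl n i x - dl n i y.
Proof. exact: linearB. Qed.

Lemma drB n i x y : dr n i (x - y) = dr n i x - dr n i y.
Proof. exact: linearB. Qed.

Lemma dBZ n i a x :
  dl n i (a *: x) - dr n i (a *: x) = a *: (dl n i x - dr n i x).
Proof. by rewrite [dl n i _]linearZ [dr n i _]linearZ -scalerBr. Qed.

Lemma bd_bd n x : bd n (bd n.+1 x) = 0.
Proof.
pose d n i x := dl n i x - dr n i x.
pose f i j := d n i (d n.+1 j x).
rewrite -[RHS](@alt_sum_diff _ n.+1 f) => [|i j ij jn].
  rewrite {1}/bd; apply: eq_bigr => i _.
  rewrite /bd (linear_sum (dl n i)) (linear_sum (dr n i)) -sumrB scaler_sumr /=.
  apply: eq_bigr => j _; rewrite dBZ.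
  rewrite scalerA -exprD addSn addnS.
  by rewrite !exprS !mulN1r opprK.
rewrite /f /d !dlB !drB.
rewrite (dl_dl _ ij jn) (dr_dr _ ij jn) (dl_dr _ ij jn) (dr_dl _ ij jn).
by rewrite !opprB addrACA [in RHS]addrACA; congr (_ + _); rewrite addrC.
Qed.

Definition YB_complex : complex k :=
  @Complex k (fun n => V n) (fun n => bd n) bd_bd.

(* Since v_(i+1) is i : 'I_m, the top u letters v_(m-u+1), ..., v_m are those *)
(* i with m - u <= i.                                                         *)
Definition uses_top u n (t : n.-tuple 'I_m) : bool :=
  [forall i : 'I_m, (m - u <= i)%N ==> (i \in t)].

Definition top_word u n := {t : n.-tuple 'I_m | uses_top u t}.

(* The quotient of V n by the span of the words omitting one of the top u      *)
(* letters is represented as the free module on the remaining words; proj is   *)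
(* the quotient map: it is onto (proj_incl), its kernel is that span           *)
(* (proj_eq0), which bd preserves (omits_bd), and it commutes with the         *)
(* differentials (proj_bd). incl sends a class to the word representing it.    *)
Definition proj u n : V n -> freemod k (top_word u n) :=
  lext (fun t => if insub t is Some s then fbasis k s else 0).

Definition incl u n : freemod k (top_word u n) -> V n :=
  lext (fun s => fbasis k (val s)).

Arguments proj : clear implicits.
Arguments incl : clear implicits.

HB.instance Definition _ u n := GRing.Linear.copy (proj u n) (lext _).
HB.instance Definition _ u n := GRing.Linear.copy (incl u n) (lext _).

Definition quot_bd u n (x : freemod k (top_word u n.+1)) :
    freemod k (top_word u n) :=
  proj u n (bd n (incl u n.+1 x)).

HB.instance Definition _ u n := GRing.Linear.copy (@quot_bd u n)
  (proj u n \o (bd n \o incl u n.+1)).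

(* Membership in the span of the words that omit one of the top u letters. *)
Definition omits u n (x : V n) : Prop := forall t, uses_top u t -> x t = 0.

Lemma projE u n x s : proj u n x s = x (val s).
Proof.
rewrite /proj /lext sum_ffunE (bigD1 (val s)) //= big1 => [|t ts].
  by rewrite valK !ffunE eqxx addr0 /GRing.scale /= mulr1.
rewrite !ffunE; case: insubP => [s' _ st|_]; rewrite ffunE ?scaler0 //.
by rewrite -val_eqE /= st eq_sym (negPf ts) scaler0.
Qed.

Lemma proj_eq0 u n x : proj u n x = 0 <-> omits u x.
Proof.
split=> [px0 t ut|ox]; last by apply/ffunP => s; rewrite projE ox ?ffunE ?(valP s).
by have := projE x (exist _ t ut); rewrite px0 ffunE.
Qed.

Lemma proj_incl u n x : proj u n (incl u n x) = x.
Proof.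
move: x; apply: free_ext => [a x y|a x y|t]; rewrite ?linearP //.
by rewrite /incl lext_basis /proj lext_basis valK.
Qed.

Lemma uses_topS u n n' (t : n.-tuple 'I_m) (t' : n'.-tuple 'I_m) :
  {subset t <= t'} -> uses_top u t -> uses_top u t'.
Proof.
move=> tt' /forallP ut; apply/forallP => i; apply/implyP => /(implyP (ut i)).
exact: tt'.
Qed.

Lemma omits_lext u n n' (f : n.-tuple 'I_m -> V n') x :
  (forall t, ~~ uses_top u t -> omits u (f t)) -> omits u x -> omits u (lext f x).
Proof.
move=> hf ox w uw; rewrite /lext sum_ffunE big1 // => t _; rewrite ffunE.
have [/ox ->|/hf ->] := boolP (uses_top u t); rewrite ?scale0r ?scaler0 //.
Qed.

Lemma omits_lin u n a b (x y : V n) :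
  omits u x -> omits u y -> omits u (a *: x + b *: y).
Proof. by move=> ox oy t ut; rewrite !ffunE ox ?oy // !scaler0 addr0. Qed.

Lemma omits_basis u n (t : n.-tuple 'I_m) : ~~ uses_top u t -> omits u (fbasis k t).
Proof. by move=> ut w uw; rewrite ffunE; case: eqP uw ut => // -> ->. Qed.

Lemma omits_YBat u n p x : omits u x -> omits u (YBat n p x).
Proof.
apply: omits_lext => t ut.
have uat : ~~ uses_top u (permw (tperm (inord p) (inord p.+1)) t).
  apply: contra ut; apply: uses_topS => i /tnthP[q ->].
  by rewrite tnth_permw mem_tnth.
case: ifP => _; first exact: omits_basis.
by apply: omits_lin; apply: omits_basis.
Qed.

Lemma omits_ops u n s x : omits u x -> omits u (ops n s x).
Proof. by move=> ox; elim: s => //= p s; apply: omits_YBat. Qed.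

Lemma omits_Del u n l x : omits u x -> omits u (Del (l : 'I_n.+1) x).
Proof.
apply: omits_lext => t ut; apply: omits_basis; apply: contra ut.
by apply: uses_topS => i /tnthP[q ->]; rewrite tnth_mktuple mem_tnth.
Qed.

Lemma omits_bd u n x : omits u x -> omits u (bd n x).
Proof.
move=> ox t ut; rewrite /bd sum_ffunE big1 // => i _.
have ol : omits u (dl n i x) by apply: omits_Del; apply: omits_ops.
have or : omits u (dr n i x) by rewrite drE; apply: omits_Del; apply: omits_ops.
by rewrite !ffunE ol // or // subr0 scaler0.
Qed.

Lemma proj_bd u n x : proj u n (bd n x) = quot_bd (proj u n.+1 x).
Proof.
apply/eqP; rewrite -subr_eq0 /quot_bd -!linearB; apply/eqP/proj_eq0/omits_bd.
by apply/proj_eq0; rewrite linearB /= proj_incl subrr.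
Qed.

Fact quot_bd_quot_bd u n (x : freemod k (top_word u n.+2)) :
  quot_bd (quot_bd x) = 0.
Proof. by rewrite {2}/quot_bd -proj_bd bd_bd linear0. Qed.

Definition quot_complex u : complex k :=
  @Complex k (fun n => freemod k (top_word u n)) (fun n => @quot_bd u n)
    (@quot_bd_quot_bd u).

End YangBaxter.

Definition final_complex (k : comPzRingType) (y2 : k) (j : nat) : complex k :=
  quot_complex y2 j (j - 1).

(* Main.v *)
From HB Require Import structures.
Require Import Defs.
From mathcomp Require Import all_boot all_order all_algebra.
From mathcomp Require Import fingroup perm zify.
From Stdlib Require Import Setoid Morphisms.

(** A weakly monotone map of letters commutes with the Yang-Baxter operator:
    the two cases of $R$ are told apart by the order alone, and when two letters
    $a < b$ are merged into one letter $c$, the combination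
    $(1-y^2)(a,b) + y^2(b,a)$ becomes $(c,c) = R(c,c)$. Such a map therefore acts
    on words by a chain map ([word_map_bd]).

    Let $h = v_{m-u}$; the bound $u < m - 1$ says that $h$ is not the smallest
    letter. The words that avoid $h$ span a copy of $C^{m-1,u}$ in $C^{m,u}$, with
    quotient $C^{m,u+1}$. Merging $h$ with the letter just below it is monotone,
    moves no word that avoids $h$, and touches none of the top $u$ letters, so it
    gives a chain retraction onto that copy. Hence
    $C^{m,u} \cong C^{m,u+1} \oplus C^{m-1,u}$ ([quot_complex_split]).

    Iterating until $u = m - 1$, where the complex is $C^{mf}$, multiplicities add
    up as in Pascal's triangle ([dsum_pascal]), which gives the binomial
    coefficients. The case $u = 0$ is the statement on $C^m$, since a quotient that
    imposes no letter is the whole complex. *)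

Set Implicit Arguments.
Unset Strict Implicit.
Unset Printing Implicit Defensive.

Import GRing.Theory.
Local Open Scope ring_scope.

(** * Isomorphisms of complexes and direct sums *)

(** Carrying the inverse maps as data makes this relation symmetric without any
    choice: bijectivity in each degree alone does not provide the family of
    inverses. *)
Definition chain_iso (k : comPzRingType) (C D : complex k) : Prop :=
  exists (f : forall n, C n -> D n) (g : forall n, D n -> C n),
    [/\ forall n, linear (f n), forall n, cancel (f n) (g n),
        forall n, cancel (g n) (f n)
      & forall n x, f n (diff C n x) = diff D n (f n.+1 x)].

Section DirectSums.
Variable k : comPzRingType.
Implicit Types C D E : complex k.

Lemma chain_iso_complex_iso C D : chain_iso C D -> complex_iso C D.
Proof.
move=> [f [g [f_lin fK gK f_diff]]].
pose F n : {linear C n -> D n} :=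
  HB.pack (f n) (GRing.isLinear.Build k (C n) (D n) _ (f n) (f_lin n)).
exists F.
by split=> // n; exists (g n).
Qed.

Lemma chain_iso_refl C : chain_iso C C.
Proof. by exists (fun=> id), (fun=> id). Qed.

Lemma chain_iso_sym C D : chain_iso C D -> chain_iso D C.
Proof.
move=> [f [g [f_lin fK gK f_diff]]]; exists g, f; split=> // n.
  by move=> a x y; apply: (can_inj (fK n)); rewrite f_lin !gK.
by move=> x; apply: (can_inj (fK n)); rewrite f_diff !gK.
Qed.

Lemma chain_iso_trans C D E : chain_iso C D -> chain_iso D E -> chain_iso C E.
Proof.
move=> [f [g [f_lin fK gK f_diff]]] [f' [g' [f'_lin f'K g'K f'_diff]]].
exists (fun n => f' n \o f n), (fun n => g n \o g' n); split=> n.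
- by move=> a x y /=; rewrite f_lin f'_lin.
- exact: can_comp.
- exact: can_comp.
- by move=> x /=; rewrite f_diff f'_diff.
Qed.

#[local] Instance chain_iso_equivalence : Equivalence (@chain_iso k) :=
  { Equivalence_Reflexive := chain_iso_refl;
    Equivalence_Symmetric := chain_iso_sym;
    Equivalence_Transitive := chain_iso_trans }.

#[local] Hint Resolve chain_iso_refl : core.

#[local] Instance dsum_chain_iso :
  Proper (@chain_iso k ==> @chain_iso k ==> @chain_iso k) (@dsum k).
Proof.
move=> C C' [f [g [f_lin fK gK f_diff]]] D D' [f' [g' [f'_lin f'K g'K f'_diff]]].
exists (fun n (x : dsum C D n) => (f n x.1, f' n x.2) : dsum C' D' n).
exists (fun n (x : dsum C' D' n) => (g n x.1, g' n x.2) : dsum C D n).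
split=> n.
- by move=> a x y; rewrite f_lin f'_lin.
- by move=> [x y] /=; rewrite fK f'K.
- by move=> [x y] /=; rewrite gK g'K.
- by move=> [x y]; rewrite /= /dsum_diff /= f_diff f'_diff.
Qed.

Lemma dsumC C D : chain_iso (dsum C D) (dsum D C).
Proof.
exists (fun n (x : dsum C D n) => (x.2, x.1) : dsum D C n).
exists (fun n (x : dsum D C n) => (x.2, x.1) : dsum C D n).
by split=> n //; case=> x y.
Qed.

Lemma dsumA C D E : chain_iso (dsum C (dsum D E)) (dsum (dsum C D) E).
Proof.
exists (fun n (x : dsum C (dsum D E) n) =>
  ((x.1, x.2.1), x.2.2) : dsum (dsum C D) E n).
exists (fun n (x : dsum (dsum C D) E n) =>
  (x.1.1, (x.1.2, x.2)) : dsum C (dsum D E) n).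
by split=> n //; [case=> x [y z] | case=> [[x y] z]].
Qed.

Lemma dsum0C C : chain_iso (dsum (zero_complex k) C) C.
Proof.
exists (fun n (x : dsum (zero_complex k) C n) => x.2).
exists (fun n (x : C n) => (0, x) : dsum (zero_complex k) C n).
by split=> n // [x y] /=; rewrite [x]thinmx0.
Qed.

Lemma dsumC0 C : chain_iso (dsum C (zero_complex k)) C.
Proof. by rewrite dsumC dsum0C. Qed.

Lemma dsumACA C D C' D' : chain_iso (dsum (dsum C D) (dsum C' D'))
                                    (dsum (dsum C C') (dsum D D')).
Proof. by rewrite -!dsumA [dsum D (dsum C' D')]dsumA [dsum D C']dsumC -dsumA. Qed.

(** A short exact sequence whose inclusion [i] has a chain retraction [r] splits.
    Only [p] and [r] enter the isomorphism itself, so [i] and the section [s] of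
    [p] need not commute with the differentials. *)
Lemma chain_iso_split C D E
    (p : forall n, {linear C n -> E n}) (r : forall n, {linear C n -> D n})
    (s : forall n, {linear E n -> C n}) (i : forall n, {linear D n -> C n}) :
  (forall n x, p n (diff C n x) = diff E n (p n.+1 x)) ->
  (forall n x, r n (diff C n x) = diff D n (r n.+1 x)) ->
  (forall n, cancel (s n) (p n)) -> (forall n, cancel (i n) (r n)) ->
  (forall n x, p n (i n x) = 0) ->
  (forall n x, i n (r n (x - s n (p n x))) = x - s n (p n x)) ->
  chain_iso C (dsum E D).
Proof.
move=> p_diff r_diff sK iK pi0 ker_p.
exists (fun n x => (p n x, r n x) : dsum E D n).
exists (fun n (x : dsum E D n) => s n x.1 + i n (x.2 - r n (s n x.1))).
split=> n.
- by move=> a x y; rewrite !linearP.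
- by move=> x /=; rewrite -linearB ker_p addrC subrK.
- by move=> [x y] /=; rewrite (linearD (p n)) (linearD (r n)) pi0 iK sK addr0 addrC subrK.
- by move=> x; rewrite p_diff r_diff.
Qed.

Lemma copiesD a b C :
  chain_iso (copies (a + b) C) (dsum (copies a C) (copies b C)).
Proof.
elim: a => [|a IHa]; first by rewrite dsum0C.
by rewrite addSn /copies !iterS -!/(copies _ _) IHa dsumA.
Qed.

Local Notation "\dsum_ ( i <- r ) F" := (\big[@dsum k/zero_complex k]_(i <- r) F)
  (at level 36, i, r at level 50, F at level 36).
Local Notation "\dsum_ ( m <= i < n ) F" :=
  (\big[@dsum k/zero_complex k]_(m <= i < n) F)
  (at level 36, m, i, n at level 50, F at level 36).

Lemma eq_big_dsum (I : Type) (s : seq I) (F G : I -> complex k) :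
  (forall i, chain_iso (F i) (G i)) ->
  chain_iso (\dsum_(i <- s) F i) (\dsum_(i <- s) G i).
Proof.
move=> FG; elim: s => [|i s IHs]; first by rewrite !big_nil.
by rewrite !big_cons IHs FG.
Qed.

Lemma big_dsum_split (I : Type) (s : seq I) (F G : I -> complex k) :
  chain_iso (\dsum_(i <- s) dsum (F i) (G i))
            (dsum (\dsum_(i <- s) F i) (\dsum_(i <- s) G i)).
Proof.
elim: s => [|i s IHs]; first by rewrite !big_nil dsum0C.
by rewrite !big_cons IHs dsumACA.
Qed.

Lemma big_dsum_rcons (I : Type) (s : seq I) j (F : I -> complex k) :
  chain_iso (\dsum_(i <- rcons s j) F i) (dsum (\dsum_(i <- s) F i) (F j)).
Proof.
elim: s => [|i s IHs] /=; first by rewrite big_cons big_nil dsum0C dsumC0.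
by rewrite !big_cons IHs dsumA.
Qed.

(** Pascal's rule, with multiplicities of complexes in place of numbers. *)
Lemma dsum_pascal n (F : nat -> complex k) :
  chain_iso (dsum (\dsum_(0 <= i < n.+1) copies 'C(n, i) (F i.+1))
                  (\dsum_(0 <= i < n.+1) copies 'C(n, i) (F i)))
            (\dsum_(0 <= i < n.+2) copies 'C(n.+1, i) (F i)).
Proof.
(* Since 'C(n, n.+1) = 0, the second sum may be extended by the index n.+1. *)
have extend : chain_iso (\dsum_(0 <= i < n.+1) copies 'C(n, i) (F i))
                        (\dsum_(0 <= i < n.+2) copies 'C(n, i) (F i)).
  rewrite /index_iota !subn0 -[n.+2]addn1 iotaD cats1 big_dsum_rcons.
  by rewrite bin_small // dsumC0.
rewrite extend !(big_nat_recl n.+1) // !bin0.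
rewrite [X in chain_iso _ (dsum _ X)]
  (eq_big_dsum _ (fun i => copiesD 'C(n, i.+1) 'C(n, i) (F i.+1))).
by rewrite big_dsum_split [X in chain_iso _ X]dsumA; apply: dsumC.
Qed.

End DirectSums.

(** * Chain maps induced by maps of letters *)

Definition word_map (k : comPzRingType) m m' (f : 'I_m -> 'I_m') n :
    freemod k (n.-tuple 'I_m) -> freemod k (n.-tuple 'I_m') :=
  lext (fun t => fbasis k (map_tuple f t)).

HB.instance Definition _ k m m' f n :=
  GRing.Linear.copy (@word_map k m m' f n) (lext _).

Section WordMap.
Variables (k : comPzRingType) (y2 : k) (m m' : nat) (f : 'I_m -> 'I_m').

Lemma word_map_basis n (t : n.-tuple 'I_m) :
  word_map f (fbasis k t) = fbasis k (map_tuple f t).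
Proof. exact: lext_basis. Qed.

Lemma permw_map n (s : 'S_n) (t : n.-tuple 'I_m) :
  permw s (map_tuple f t) = map_tuple f (permw s t).
Proof. by apply: eq_from_tnth => i; rewrite !(tnth_map, tnth_mktuple). Qed.

Lemma word_map_Del n (l : 'I_n.+1) (x : freemod k (n.+1.-tuple 'I_m)) :
  word_map f (Del l x) = Del l (word_map f x).
Proof.
move: x; apply: free_ext => [a x y|a x y|t]; rewrite ?linearP //.
rewrite Del_basis !word_map_basis Del_basis; congr fbasis.
by apply: eq_from_tnth => i; rewrite !(tnth_map, tnth_mktuple).
Qed.

Hypothesis f_mono : {homo f : a b / (a <= b)%N}.

Lemma word_map_YB n (i j : 'I_n) x :
  word_map f (YB y2 i j x) = YB y2 i j (word_map f x).
Proof.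
move: x; apply: free_ext => [a x y|a x y|t]; rewrite ?linearP //.
rewrite word_map_basis !YB_basis !tnth_map permw_map.
case: leqP => [/f_mono -> | lt_ij]; first by rewrite word_map_basis.
rewrite linearD !linearZ /= !word_map_basis; case: leqP => // le_f.
(* The letters a < b at positions i and j are merged by f. *)
have ffE : f (tnth t i) = f (tnth t j).
  by apply/val_inj/eqP; rewrite eqn_leq le_f f_mono // ltnW.
have -> : map_tuple f (permw (tperm i j) t) = map_tuple f t.
  apply: eq_from_tnth => p; rewrite tnth_map tnth_permw tnth_map.
  by case: tpermP => // ->.
by rewrite -scalerDl subrK scale1r.
Qed.

Lemma word_map_bd n (x : freemod k (n.+1.-tuple 'I_m)) :
  word_map f (bd y2 x) = bd y2 (word_map f x).
Proof.
rewrite /bd linear_sum; apply: eq_bigr => i _ /=.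
rewrite linearZ linearB /=; congr (_ *: (_ - _)).
  rewrite /dl word_map_Del; congr Del.
  by elim: (iota 0 i) => //= p s <-; rewrite word_map_YB.
rewrite /dr word_map_Del; congr Del.
by elim: (iota i (n - i)) x => //= p s IHs x; rewrite IHs word_map_YB.
Qed.

End WordMap.

Section QuotientMap.
Variable k : comPzRingType.

Definition TopWord m u n (t : n.-tuple 'I_m) (ut : uses_top u t) :
  top_word m u n := exist _ t ut.

Lemma proj_basis m u n (t : n.-tuple 'I_m) (ut : uses_top u t) :
  proj u (fbasis k t) = fbasis k (TopWord ut).
Proof. by rewrite /proj lext_basis insubT. Qed.

Lemma proj_basis0 m u n (t : n.-tuple 'I_m) :
  ~~ uses_top u t -> proj u (fbasis k t) = 0.
Proof. by move=> ut; apply/proj_eq0/omits_basis. Qed.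

(** The linear map between quotients given on classes of words by [f]. A map
    between the words themselves would not do, since the image of a basis word may
    vanish in the target; [quot_map_bd] gives conditions for a chain map. *)
Definition quot_map m m' (f : 'I_m -> 'I_m') u u' n
    (x : freemod k (top_word m u n)) : freemod k (top_word m' u' n) :=
  proj u' (word_map f (incl x)).

HB.instance Definition _ m m' f u u' n :=
  GRing.Linear.copy (@quot_map m m' f u u' n)
    (@proj k m' u' n \o (@word_map k m m' f n \o @incl k m u n)).

Lemma quot_map_basis m m' (f : 'I_m -> 'I_m') u u' n (s : top_word m u n) :
  quot_map f u' (fbasis k s) = proj u' (fbasis k (map_tuple f (val s))).
Proof. by rewrite /quot_map /incl lext_basis word_map_basis. Qed.

Lemma quot_map_bd (y2 : k) m m' (f : 'I_m -> 'I_m') u u' n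
    (x : freemod k (top_word m u n.+1)) :
  {homo f : a b / (a <= b)%N} ->
  (forall n (t : n.-tuple 'I_m), uses_top u' (map_tuple f t) -> uses_top u t) ->
  quot_map f u' (quot_bd y2 x) = quot_bd y2 (quot_map f u' x).
Proof.
move=> f_mono f_top.
have quot_map_proj (z : freemod k (n.-tuple 'I_m)) :
    quot_map f u' (proj u z) = proj u' (word_map f z).
  move: z; apply: free_ext => [a z z'|a z z'|t]; rewrite ?linearP //.
  have [ut|ut] := boolP (uses_top u t); last first.
    rewrite proj_basis0 // linear0 word_map_basis proj_basis0 //.
    exact: contra (f_top _ _) ut.
  by rewrite proj_basis quot_map_basis word_map_basis.
by rewrite {1}/quot_bd quot_map_proj word_map_bd // proj_bd.
Qed.

End QuotientMap.

(** * Splitting off the words that avoid a letter *)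

Section Split.
Variables (k : comPzRingType) (y2 : k) (m u : nat).
Hypothesis le_um : (u <= m)%N.

(** The letter $v_{m+2-u}$, the largest one below the top [u] letters. *)
Let h : 'I_m.+2 := inord (m.+1 - u).

(** Merges [h] with the letter just below it; on the other letters it is the
    inverse of [lift h]. *)
Let collapse (a : 'I_m.+2) : 'I_m.+1 := inord (unbump (m - u) a).

Let hE : h = (m.+1 - u)%N :> nat.
Proof. by rewrite inordK //; lia. Qed.

Let collapseE a : collapse a = unbump (m - u) a :> nat.
Proof. by rewrite inordK //; rewrite /unbump; have := ltn_ord a; lia. Qed.

Let collapse_mono : {homo collapse : a b / (a <= b)%N}.
Proof. by move=> a b; rewrite !collapseE /unbump; lia. Qed.

Let lift_hK : cancel (lift h) collapse.
Proof.
by case=> a lt_a; apply: val_inj; rewrite /= collapseE /unbump /= /bump hE /=; lia.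
Qed.

Let collapseK a : a != h -> lift h (collapse a) = a.
Proof. by rewrite eq_sym => /unlift_some[b -> _]; rewrite lift_hK. Qed.

(** Both letters that are merged lie below the top [u], and the collapse maps the
    top [u] letters onto the top [u] letters. *)
Let collapse_top n (t : n.-tuple 'I_m.+2) :
  uses_top u (map_tuple collapse t) = uses_top u t.
Proof.
apply/forallP/forallP => ut i; apply/implyP => i_top.
  have /(implyP (ut (collapse i)))/mapP[a ta] : (m.+1 - u <= collapse i)%N.
    by rewrite collapseE /unbump; lia.
  move/(congr1 val); rewrite /= !collapseE /unbump => ai.
  by suff -> : i = a by []; apply: val_inj => /=; lia.
have /(implyP (ut (lift h i))) : (m.+2 - u <= lift h i)%N by rewrite /= /bump hE; lia.
by move/(map_f collapse); rewrite lift_hK.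
Qed.

Let uses_topS_h n (t : n.-tuple 'I_m.+2) :
  uses_top u.+1 t = (h \in t) && uses_top u t.
Proof.
apply/forallP/andP => [ut | [ht /forallP ut] i].
  split; first by apply: (implyP (ut h)); rewrite hE; lia.
  by apply/forallP => i; apply/implyP => i_top; apply: (implyP (ut i)); lia.
apply/implyP => i_top; have [->//|ih] := eqVneq i h.
by apply: (implyP (ut i)); move: ih; rewrite -val_eqE /= hE; lia.
Qed.

Let map_lift_collapse n (t : n.-tuple 'I_m.+2) :
  h \notin t -> map_tuple (lift h) (map_tuple collapse t) = t.
Proof.
move=> ht; apply: eq_from_tnth => i; rewrite !tnth_map collapseK //.
by apply: contra ht => /eqP <-; apply: mem_tnth.
Qed.

Let map_collapse_lift n (t : n.-tuple 'I_m.+1) :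
  map_tuple collapse (map_tuple (lift h) t) = t.
Proof. by apply: eq_from_tnth => i; rewrite !tnth_map lift_hK. Qed.

Let map_id n (t : n.-tuple 'I_m.+2) : map_tuple id t = t.
Proof. by apply: eq_from_tnth => i; rewrite tnth_map. Qed.

(** The quotient map is [quot_map id], the retraction is [quot_map collapse] and
    the inclusion is [quot_map (lift h)]; the section of the quotient map sends a
    word to itself. *)
Lemma quot_complex_split :
  chain_iso (quot_complex y2 m.+2 u)
            (dsum (quot_complex y2 m.+2 u.+1) (quot_complex y2 m.+1 u)).
Proof.
pose p n : {linear freemod k (top_word m.+2 u n) -> freemod k (top_word m.+2 u.+1 n)} :=
  @quot_map k _ _ id u u.+1 n.
pose r n : {linear freemod k (top_word m.+2 u n) -> freemod k (top_word m.+1 u n)} :=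
  @quot_map k _ _ collapse u u n.
pose s n : {linear freemod k (top_word m.+2 u.+1 n) -> freemod k (top_word m.+2 u n)} :=
  @quot_map k _ _ id u.+1 u n.
pose i n : {linear freemod k (top_word m.+1 u n) -> freemod k (top_word m.+2 u n)} :=
  @quot_map k _ _ (lift h) u u n.
have lift_top n (t : n.-tuple 'I_m.+1) : uses_top u t -> uses_top u (map_tuple (lift h) t).
  by move=> ut; rewrite -collapse_top map_collapse_lift.
have iE n (t : top_word m.+1 u n) :
    i n (fbasis k t) = fbasis k (TopWord (lift_top _ _ (valP t))).
  by rewrite -proj_basis; apply: quot_map_basis.
have sE n (t : top_word m.+2 u.+1 n) (ut : uses_top u (val t)) :
    s n (fbasis k t) = fbasis k (TopWord ut).
  by rewrite -proj_basis [LHS]quot_map_basis map_id.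
have collapse_topw n (t : top_word m.+2 u n) : uses_top u (map_tuple collapse (val t)).
  by rewrite collapse_top; apply: valP.
have rE n (t : top_word m.+2 u n) :
    r n (fbasis k t) = fbasis k (TopWord (collapse_topw _ t)).
  by rewrite -proj_basis; apply: quot_map_basis.
have pE n (t : top_word m.+2 u n) : p n (fbasis k t) = proj u.+1 (fbasis k (val t)).
  by rewrite [LHS]quot_map_basis map_id.
apply: (@chain_iso_split _ (quot_complex y2 m.+2 u) (quot_complex y2 m.+1 u)
  (quot_complex y2 m.+2 u.+1) p r s i) => n.
- move=> x; apply: quot_map_bd => // n' t.
  by rewrite map_id uses_topS_h => /andP[].
- by move=> x; apply: quot_map_bd => // n' t; rewrite collapse_top.
- apply: free_ext => [a x y|a x y|t]; rewrite ?linearP //.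
  have /andP[_ ut] : (h \in val t) && uses_top u (val t).
    by rewrite -uses_topS_h; apply: valP.
  rewrite sE pE (proj_basis k (valP t)); congr fbasis; exact: val_inj.
- apply: free_ext => [a x y|a x y|t]; rewrite ?linearP //.
  by rewrite iE rE; congr fbasis; apply: val_inj; rewrite /= map_collapse_lift.
- apply: free_ext => [a x y|a x y|t]; rewrite ?linearP ?scaler0 ?addr0 //.
  rewrite iE pE proj_basis0 // uses_topS_h negb_and; apply/orP; left.
  by apply/negP => /= /mapP[a _ /eqP]; rewrite (negPf (neq_lift h a)).
- (* On a word t using h, s (p t) = t; on a word avoiding h, p t = 0. *)
  pose q x := x - s n (p n x).
  have q_lin : linear q.
    by move=> a x y; rewrite /q (linearP (p n)) (linearP (s n)) opprD addrACA scalerBr.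
  apply: free_ext => [a x y|a x y|t]; rewrite -?/(q _) ?q_lin ?linearP //.
  rewrite /q pE; have [ht|ht] := boolP (h \in val t); last first.
    rewrite proj_basis0 ?uses_topS_h ?(negPf ht) // linear0 subr0 rE iE.
    by congr fbasis; apply: val_inj; rewrite /= map_lift_collapse.
  have ut : uses_top u.+1 (val t) by rewrite uses_topS_h ht; apply: valP.
  rewrite proj_basis (sE _ (TopWord ut) (valP t)).
  suff -> : TopWord (valP t) = t by rewrite subrr !linear0.
  exact: val_inj.
Qed.

End Split.

(** * The decomposition into final complexes *)

Lemma quot_complex_decomposition (k : comPzRingType) (y2 : k) n u :
  chain_iso (quot_complex y2 (n + u).+1 u)
    (\big[@dsum k/zero_complex k]_(0 <= i < n.+1)
       copies 'C(n, i) (final_complex y2 (i + u.+1))).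
Proof.
elim: n u => [|n IHn] u.
  rewrite big_ltn // big_geq // bin0 /final_complex !add0n subn1 /=.
  apply: chain_iso_sym; apply: chain_iso_trans (dsumC0 _) _; exact: dsumC0.
apply: chain_iso_trans (quot_complex_split y2 (leq_addl n u)) _.
have IHnS := IHn u.+1; rewrite addnS in IHnS.
apply: chain_iso_trans (dsum_chain_iso IHnS (IHn u)) _.
apply: chain_iso_trans (dsum_pascal n (fun i => final_complex y2 (i + u.+1))).
by under eq_bigr do rewrite addnS -addSn; apply: chain_iso_refl.
Qed.

Lemma YB_complex_quot0 (k : comPzRingType) (y2 : k) m :
  chain_iso (YB_complex y2 m) (quot_complex y2 m 0).
Proof.
have top0 n (t : n.-tuple 'I_m) : uses_top 0 t.
  by apply/forallP => i; rewrite subn0 leqNgt ltn_ord.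
exists (fun n => @proj k m 0 n), (fun n => @incl k m 0 n); split=> n.
- exact: linearP.
- apply: free_ext => [a x y|a x y|t]; rewrite ?linearP //.
  by rewrite (proj_basis k (top0 n t)) /incl lext_basis.
- exact: proj_incl.
- exact: proj_bd.
Qed.

Theorem theorem3p7 (k : comPzRingType) (y2 : k) :
  (forall m u : nat, (u < m - 1)%N ->
     complex_iso (quot_complex y2 m u)
       (\big[@dsum k/zero_complex k]_(u.+1 <= j < m.+1)
          copies 'C(m - u - 1, j - u - 1) (final_complex y2 j))) /\
  (forall m : nat, (0 < m - 1)%N ->
     complex_iso (YB_complex y2 m)
       (\big[@dsum k/zero_complex k]_(1 <= j < m.+1)
          copies 'C(m - 1, j - 1) (final_complex y2 j))).
Proof.
have decomp m u : (u < m - 1)%N -> chain_iso (quot_complex y2 m u)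
    (\big[@dsum k/zero_complex k]_(u.+1 <= j < m.+1)
       copies 'C(m - u - 1, j - u - 1) (final_complex y2 j)).
  move=> lt_um; have [n ->] : exists n, m = (n + u).+1.
    by exists (m - u.+1)%N; lia.
  rewrite -[u.+1]add0n big_addn.
  have -> : ((n + u).+2 - u.+1 = n.+1)%N by lia.
  under eq_bigr => i _.
    have -> : ((n + u).+1 - u - 1 = n)%N by lia.
    have -> : (i + u.+1 - u - 1 = i)%N by lia.
    over.
  exact: quot_complex_decomposition.
split=> m; first by move=> u /decomp /chain_iso_complex_iso.
move=> /decomp dec_m; apply: chain_iso_complex_iso.
apply: chain_iso_trans (YB_complex_quot0 y2 m) _.
by move: dec_m; rewrite subn0; under eq_bigr do rewrite subn0.
Qed.
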